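(* Let $0\le l\le n$. Let $A\in \mathrm{GL}_n(k((z)))$ have dominant coweight $\rho(A)=(1^l)=(1^l,0^{n-l})$ and let $B\in\mathrm{GL}_n(k((z)))$. Write the symmetric coweights as $\sigma(B)=(a_1,\dots,a_n)$ and $\sigma(AB)=(b_1,\dots,b_n)$, in decreasing order. Then $a_i-1\le b_i\le a_i+1$ for all $1\le i\le n$.
   Context: $k$ is a finite field with $\mathrm{char}(k)\ne 2$. Let $G=\mathrm{GL}_n(k((z)))$, $K=\mathrm{GL}_n(k[[z]])$, $H=\mathrm{GL}_n(k((z^2)))$. Dominant coweight: every $g\in G$ lies in $K\,\mathrm{diag}(z^{\lambda_1},\dots,z^{\lambda_n})\,K$ for a unique sequence of integers $\lambda_1\ge\dots\ge\lambda_n$; put $\rho(g)=(\lambda_1,\dots,\lambda_n)$. Strings of zeros in such sequences may be omitted when writing them. Symmetric coweight: every $g\in G$ lies in $K\Lambda H$ for a block diagonal matrix $\Lambda$ with diagonal blocks among $(1)$, $(z)$, $\begin{pmatrix}1&z\\0&z^i\end{pmatrix}$ ($i>1$), and $\Lambda$ is unique up to the order of the blocks. The symmetric coweight $\sigma(g)$ is the decreasing sequence of length $n$ obtained by letting each block $(1)$ contribute $0$, each block $(z)$ contribute $1$, and each block $\begin{pmatrix}1&z\\0&z^i\end{pmatrix}$ contribute $i$ and $0$. *)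

(* Defs.v *)
From HB Require Import structures.
From mathcomp Require Import all_boot all_order all_algebra.
From mathcomp.classical Require Import boolp.

Set Implicit Arguments.
Unset Strict Implicit.
Unset Printing Implicit Defensive.

Import Order.TTheory GRing.Theory Num.Theory.
Local Open Scope ring_scope.

Record fps (k : Type) := FPS { fps_coef : nat -> k }.

HB.instance Definition _ (k : Type) := gen_eqMixin (fps k).
HB.instance Definition _ (k : Type) := gen_choiceMixin (fps k).

Lemma fpsP (k : Type) (p q : fps k) : fps_coef p =1 fps_coef q -> p = q.
Proof. by case: p => p; case: q => q /= /funext ->. Qed.

Section FpsZmodule.
Variable k : zmodType.
Implicit Types p q r : fps k.

Definition fps_zero : fps k := FPS (fun _ => 0).
Definition fps_opp p : fps k := FPS (fun i => - fps_coef p i).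
Definition fps_add p q : fps k := FPS (fun i => fps_coef p i + fps_coef q i).

Fact fps_addA : associative fps_add.
Proof. by move=> p q r; apply: fpsP => i /=; rewrite addrA. Qed.
Fact fps_addC : commutative fps_add.
Proof. by move=> p q; apply: fpsP => i /=; rewrite addrC. Qed.
Fact fps_add0 : left_id fps_zero fps_add.
Proof. by move=> p; apply: fpsP => i /=; rewrite add0r. Qed.
Fact fps_addN : left_inverse fps_zero fps_opp fps_add.
Proof. by move=> p; apply: fpsP => i /=; rewrite addNr. Qed.

HB.instance Definition _ :=
  GRing.isZmodule.Build (fps k) fps_addA fps_addC fps_add0 fps_addN.

Lemma fps_coef0 i : fps_coef (0 : fps k) i = 0. Proof. by []. Qed.
Lemma fps_coefD p q i : fps_coef (p + q) i = fps_coef p i + fps_coef q i.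
Proof. by []. Qed.
Lemma fps_coefN p i : fps_coef (- p) i = - fps_coef p i.
Proof. by []. Qed.

End FpsZmodule.

Section FpsRing.
Variable k : fieldType.
Implicit Types p q r : fps k.

Definition fps_one : fps k := FPS (fun i => (i == 0%N)%:R).
Definition fps_mul p q : fps k :=
  FPS (fun n => \sum_(i < n.+1) fps_coef p i * fps_coef q (n - i)%N).

Definition fps_trunc m p : {poly k} := \poly_(i < m) fps_coef p i.

Lemma coef_fps_trunc m p i : (i < m)%N -> (fps_trunc m p)`_i = fps_coef p i.
Proof. by move=> lt_im; rewrite coef_poly lt_im. Qed.

Lemma fps_coef_mul_trunc p q n :
  fps_coef (fps_mul p q) n = (fps_trunc n.+1 p * fps_trunc n.+1 q)`_n.
Proof.
rewrite coefM; apply: eq_bigr => i _.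
by rewrite !coef_fps_trunc // ltnS leq_subr.
Qed.

Lemma fps_coef_trunc_mul m p q i : (i < m)%N ->
  (fps_trunc m p * fps_trunc m q)`_i = fps_coef (fps_mul p q) i.
Proof.
move=> lt_im; rewrite coefM; apply: eq_bigr => j _.
have le_ji : (j <= i)%N by rewrite -ltnS.
by rewrite !coef_fps_trunc ?(leq_ltn_trans _ lt_im) ?leq_subr.
Qed.

Fact fps_mulC : commutative fps_mul.
Proof. by move=> p q; apply: fpsP => n; rewrite !fps_coef_mul_trunc mulrC. Qed.

Fact fps_mulA : associative fps_mul.
Proof.
move=> p q r; apply: fpsP => n; rewrite !fps_coef_mul_trunc.
set t := fps_trunc n.+1.
transitivity ((t p * (t q * t r))`_n).
  rewrite !coefM; apply: eq_bigr => i _; congr (_ * _).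
  have lt_n : (n - i < n.+1)%N by rewrite ltnS leq_subr.
  by rewrite coef_fps_trunc // fps_coef_trunc_mul.
rewrite mulrA !coefM; apply: eq_bigr => i _; congr (_ * _).
by rewrite [RHS]coef_fps_trunc // fps_coef_trunc_mul.
Qed.

Fact fps_mul1 : left_id fps_one fps_mul.
Proof.
move=> p; apply: fpsP => n /=.
rewrite big_ord_recl /= mul1r subn0 big1 ?addr0 // => i _.
by rewrite mul0r.
Qed.

Fact fps_mulDl : left_distributive fps_mul +%R.
Proof.
move=> p q r; apply: fpsP => n /=.
by rewrite -big_split; apply: eq_bigr => i _; rewrite mulrDl.
Qed.

Fact fps_one_neq0 : fps_one != 0.
Proof.
apply/eqP => /(congr1 (fun p => fps_coef p 0)) /= /eqP.
by rewrite oner_eq0.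
Qed.

HB.instance Definition _ := GRing.Zmodule_isComNzRing.Build (fps k)
  fps_mulA fps_mulC fps_mul1 fps_mulDl fps_one_neq0.

Lemma fps_coef1 i : fps_coef (1 : fps k) i = (i == 0%N)%:R. Proof. by []. Qed.
Lemma fps_coefM p q n :
  fps_coef (p * q) n = \sum_(i < n.+1) fps_coef p i * fps_coef q (n - i)%N.
Proof. by []. Qed.

(* [fps_inv_seq p n] lists the first n + 1 coefficients of 1 / p. *)
Fixpoint fps_inv_seq p (n : nat) : seq k :=
  if n is m.+1 then
    let s := fps_inv_seq p m in
    rcons s (- (fps_coef p 0)^-1 *
             \sum_(i < m.+1) fps_coef p i.+1 * s`_(m - i))
  else [:: (fps_coef p 0)^-1].

Definition fps_unit : {pred fps k} := [pred p | fps_coef p 0 != 0].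

Definition fps_inv p : fps k :=
  if p \in fps_unit then FPS (fun n => (fps_inv_seq p n)`_n) else p.

Lemma size_fps_inv_seq p n : size (fps_inv_seq p n) = n.+1.
Proof. by elim: n => //= n IHn; rewrite size_rcons IHn. Qed.

Lemma nth_fps_inv_seq p m j : (j <= m)%N ->
  (fps_inv_seq p m)`_j = (fps_inv_seq p j)`_j.
Proof.
elim: m => [|m IHm]; first by rewrite leqn0 => /eqP->.
rewrite leq_eqVlt => /predU1P[-> //|lt_jm].
by rewrite [in LHS]/= nth_rcons size_fps_inv_seq lt_jm IHm.
Qed.

Fact fps_mulVx : {in fps_unit, left_inverse 1 fps_inv *%R}.
Proof.
move=> p p_unit; rewrite mulrC; apply: fpsP => n.
rewrite /fps_inv p_unit fps_coefM fps_coef1.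
have p0 : fps_coef p 0 != 0 by [].
case: n => [|n]; first by rewrite big_ord1 /= divff.
rewrite big_ord_recl /= nth_rcons size_fps_inv_seq ltnn eqxx.
rewrite mulrA mulrN divff // mulN1r; apply/eqP; rewrite addrC subr_eq0.
apply/eqP; apply: eq_bigr => i _.
by rewrite subSS [in RHS]nth_fps_inv_seq // leq_subr.
Qed.

Fact fps_unitPl p q : q * p = 1 -> fps_unit p.
Proof.
move=> /(congr1 (fun r => fps_coef r 0)).
rewrite fps_coefM big_ord1 fps_coef1 subnn => qp1; apply/eqP => p0.
by move/eqP: qp1; rewrite p0 mulr0 eq_sym oner_eq0.
Qed.

Fact fps_inv_out : {in [predC fps_unit], fps_inv =1 id}.
Proof. by move=> p; rewrite inE /fps_inv => /negbTE ->. Qed.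

HB.instance Definition _ := GRing.ComNzRing_hasMulInverse.Build (fps k)
  fps_mulVx fps_unitPl fps_inv_out.

Lemma fps_ord_exists p : p != 0 ->
  exists2 m, fps_coef p m != 0 & forall i, (i < m)%N -> fps_coef p i = 0.
Proof.
move=> p_neq0; have ex_m : exists m, fps_coef p m != 0.
  apply: contrapT => p0; case/eqP: p_neq0; apply: fpsP => i.
  by apply/eqP/negPn/negP => pi; apply: p0; exists i.
case: (ex_minnP ex_m) => m pm min_m; exists m => // i lt_im.
by apply/eqP; apply: contraLR lt_im => /min_m; rewrite -leqNgt.
Qed.

Fact fps_idomain : GRing.integral_domain_axiom (fps k).
Proof.
move=> p q pq0; apply/norP => -[/fps_ord_exists[m pm p_lt]].
move=> /fps_ord_exists[n qn q_lt].
have: fps_coef (p * q) (m + n) = 0 by rewrite pq0.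
have lt_m : (m < (m + n).+1)%N by rewrite ltnS leq_addr.
rewrite fps_coefM (bigD1 (Ordinal lt_m)) //= addKn big1 ?addr0.
  by move/eqP; rewrite mulf_eq0 (negbTE pm) (negbTE qn).
move=> i ne_im; case: (ltngtP i m) => [lt_im|lt_mi|eq_im].
- by rewrite p_lt ?mul0r.
- rewrite q_lt ?mulr0 //.
  by rewrite ltn_subLR ?ltn_add2r // -ltnS ltn_ord.
- by case/eqP: ne_im; apply: val_inj.
Qed.

HB.instance Definition _ := GRing.ComUnitRing_isIntegral.Build (fps k) fps_idomain.

Definition fpsX : fps k := FPS (fun i => (i == 1%N)%:R).

End FpsRing.

(* k((z)), as the fraction field of k[[z]]; embedded by [tofrac]. *)
Notation laurent k := {fraction (fps k)}.

Section Laurent.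
Variable k : fieldType.

Local Notation "x %:F" := (@tofrac (fps k) x).

Definition lz : laurent k := (fpsX k)%:F.

Definition fps_even (p : fps k) : Prop := forall i, odd i -> fps_coef p i = 0.

(* k((z^2)), as the fraction field of k[[z^2]] inside k((z)). *)
Definition in_laurent_z2 (x : laurent k) : Prop :=
  exists p q : fps k, [/\ fps_even p, fps_even q, q != 0 &
    x = p%:F / q%:F].

Variable n : nat.

Definition in_G (g : 'M[laurent k]_n) : Prop := g \in unitmx.

Definition in_K (g : 'M[laurent k]_n) : Prop :=
  exists2 u : 'M[fps k]_n, u \in unitmx & g = map_mx (@tofrac (fps k)) u.

Definition in_H (g : 'M[laurent k]_n) : Prop :=
  g \in unitmx /\ forall i j, in_laurent_z2 (g i j).

Definition zdiag (lam : n.-tuple int) : 'M[laurent k]_n :=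
  diag_mx (\row_i lz ^ tnth lam i).

(* [dominant_coweight g lam] is the graph of rho: it reads rho(g) = lam. *)
Definition dominant_coweight (g : 'M[laurent k]_n) (lam : n.-tuple int) : Prop :=
  sorted >=%R lam /\
  exists k1 k2 : 'M[laurent k]_n,
    [/\ in_K k1, in_K k2 & g = k1 *m zdiag lam *m k2].

End Laurent.

Inductive sym_block : Type :=
| Block1
| Blockz
| BlockU of nat.

Definition sym_block_ok (b : sym_block) : bool :=
  if b is BlockU i then (1 < i)%N else true.

Definition sym_block_size (b : sym_block) : nat :=
  if b is BlockU _ then 2 else 1.

Definition sym_block_mx (k : fieldType) (b : sym_block) :
    'M[laurent k]_(sym_block_size b) :=
  match b with
  | Block1 => 1%:M
  | Blockz => (lz k)%:M
  | BlockU i => block_mx (1%:M : 'M_1) (lz k)%:M 0 (lz k ^+ i)%:M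
  end.

Definition sym_block_coweight (b : sym_block) : seq int :=
  match b with
  | Block1 => [:: 0]
  | Blockz => [:: 1]
  | BlockU i => [:: i%:Z; 0]
  end.

Definition sym_blocks_size (bs : seq sym_block) : nat :=
  \sum_(i < size bs) sym_block_size (tnth (in_tuple bs) i).

Definition sym_blocks_mx (k : fieldType) (bs : seq sym_block) :
    'M[laurent k]_(sym_blocks_size bs) :=
  \mxdiag_(i < size bs) sym_block_mx k (tnth (in_tuple bs) i).

(* [symmetric_coweight g a] is the graph of sigma: it reads sigma(g) = a. *)
Definition symmetric_coweight (k : fieldType) (n : nat)
    (g : 'M[laurent k]_n) (a : n.-tuple int) : Prop :=
  exists (bs : seq sym_block) (en : sym_blocks_size bs = n)
         (u h : 'M[laurent k]_n),
    [/\ all sym_block_ok bs, in_K u, in_H h,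
        g = u *m castmx (en, en) (sym_blocks_mx k bs) *m h &
        a = sort >=%R (flatten [seq sym_block_coweight b | b <- bs]) :> seq int].

(* Main.v *)
(* Write F = k((z^2)), O = k[[z]], and attach to g the lattice
   L(g) = { x | g x in O^n }: multiplying g on the left by K does not change it,
   and multiplying g on the right by H moves it by an automorphism of F^n.
   For m >= 0 let Y_m(L) be the set of the vectors of L that lie in z F^n and are
   congruent to a vector of F^n modulo z^m L.  A computation on the blocks shows
   that the image of Y_m(L) in L/zL has dimension at most #{ j | s_j > m } when
   L = L(g) and s = sigma(g).

   Conversely, every block of exponent > m + 1 of M = L(g') gives p in F^n and
   q in z F^n, both in M and congruent modulo z^(m+1) M, the classes of the p's
   being independent in M/zM.  Let zM <= L <= M.  Among the combinations p_c,
   those in L have q_c in Y_m(L), and the other ones have z p_c in Y_m(L); this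
   yields as many independent classes in L/zL as there are blocks, so that
   #{ j | s'_j > m + 1 } <= #{ j | s_j > m }.

   The condition on A means that z L(AB) <= L(B) <= L(AB), whence the bound for
   (M, L) = (L(AB), L(B)).  The same argument applies to (z^-1 L(B), L(AB)), with
   (p, q) replaced by (q/z, p/z), and gives the bound in the other direction. *)
Require Import Defs.
From HB Require Import structures.
From mathcomp Require Import all_boot all_order all_algebra.
From mathcomp.classical Require Import boolp.
From mathcomp Require Import ring zify.

Set Implicit Arguments.
Unset Strict Implicit.
Unset Printing Implicit Defensive.

Import Order.TTheory GRing.Theory Num.Theory.
Local Open Scope ring_scope.

Local Notation "x %:F" := (@tofrac _ x).

(** * Integral and even Laurent series, and reduction modulo z *)

Section Scalars.
Variable k : fieldType.
Implicit Types (p q r : fps k) (x y : laurent k) (c d : k).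

Definition fps_const c : fps k := FPS (fun i => if i == 0%N then c else 0).

Fact fps_const_zmod : zmod_morphism fps_const.
Proof.
move=> c d; apply: fpsP => i; rewrite fps_coefD fps_coefN.
by case: i => [|i] //=; rewrite subr0.
Qed.

Lemma fps_coef_constM c p i : fps_coef (fps_const c * p) i = c * fps_coef p i.
Proof.
rewrite fps_coefM big_ord_recl /= subn0 big1 ?addr0 // => j _.
by rewrite mul0r.
Qed.

Fact fps_const_monoid : monoid_morphism fps_const.
Proof.
split=> [|c d]; apply: fpsP => i; first by case: i.
by rewrite fps_coef_constM; case: i => [|i] //=; rewrite mulr0.
Qed.

HB.instance Definition _ :=
  GRing.isZmodMorphism.Build k (fps k) fps_const fps_const_zmod.
HB.instance Definition _ :=
  GRing.isMonoidMorphism.Build k (fps k) fps_const fps_const_monoid.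

Definition scal : k -> laurent k := @tofrac (fps k) \o fps_const.
HB.instance Definition _ := GRing.RMorphism.on scal.

Lemma fps_coefXM p i : fps_coef (fpsX k * p) i.+1 = fps_coef p i.
Proof.
rewrite fps_coefM big_ord_recl big_ord_recl /= mul0r add0r mul1r subSS subn0.
by rewrite big1 ?addr0 // => j _; rewrite mul0r.
Qed.

Lemma fps_coefXM0 p : fps_coef (fpsX k * p) 0 = 0.
Proof. by rewrite fps_coefM big_ord1 mul0r. Qed.

Definition integral : {pred laurent k} :=
  [pred x | `[< exists r, x = r%:F >]].

Lemma integralP x : reflect (exists r, x = r%:F) (x \in integral).
Proof. exact: asboolP. Qed.

Fact integral_subring : subring_closed integral.
Proof.
split; first by apply/integralP; exists 1; rewrite rmorph1.
- move=> x y /integralP[p ->] /integralP[q ->].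
  by apply/integralP; exists (p - q); rewrite rmorphB.
- move=> x y /integralP[p ->] /integralP[q ->].
  by apply/integralP; exists (p * q); rewrite rmorphM.
Qed.
HB.instance Definition _ :=
  GRing.isSubringClosed.Build (laurent k) integral integral_subring.

Lemma integral_tofrac p : p%:F \in integral.
Proof. by apply/integralP; exists p. Qed.

Lemma lz_integral : lz k \in integral. Proof. exact: integral_tofrac. Qed.

Lemma lz_neq0 : lz k != 0.
Proof.
rewrite tofrac_eq0; apply/eqP => /(congr1 (fun p => fps_coef p 1)) /= /eqP.
by rewrite oner_eq0.
Qed.

Lemma scal_integral c : scal c \in integral. Proof. exact: integral_tofrac. Qed.

Definition even_laurent : {pred laurent k} := [pred x | `[< in_laurent_z2 x >]].

Lemma even_laurentP x : reflect (in_laurent_z2 x) (x \in even_laurent).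
Proof. exact: asboolP. Qed.

Lemma fps_evenB p q : fps_even p -> fps_even q -> fps_even (p - q).
Proof.
by move=> ep eq i oi; rewrite fps_coefD fps_coefN ep // eq // subr0.
Qed.

Lemma fps_evenM p q : fps_even p -> fps_even q -> fps_even (p * q).
Proof.
move=> ep eq i oi; rewrite fps_coefM big1 // => j _.
case oj: (odd j); first by rewrite ep ?mul0r.
by rewrite eq ?mulr0 // oddB 1?oi ?oj // -ltnS.
Qed.

Lemma fps_even_const c : fps_even (fps_const c).
Proof. by case. Qed.

Fact even_laurent_divring : divring_closed even_laurent.
Proof.
have e1 : fps_even (1 : fps k).
  by rewrite -(rmorph1 fps_const); apply: fps_even_const.
split.
- apply/even_laurentP; exists 1, 1.
  by split=> //; rewrite ?oner_eq0 // rmorph1 divr1.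
- move=> x y /even_laurentP[p [q [ep eq q0 ->]]].
  move=> /even_laurentP[p' [q' [ep' eq' q0' ->]]].
  apply/even_laurentP; exists (p * q' - p' * q), (q * q'); split.
  + by apply: fps_evenB; apply: fps_evenM.
  + exact: fps_evenM.
  + by rewrite mulf_neq0.
  + by rewrite -mulNr addf_div ?tofrac_eq0 // rmorphB !rmorphM mulNr.
- move=> x y /even_laurentP[p [q [ep eq q0 ->]]].
  move=> /even_laurentP[p' [q' [ep' eq' q0' ->]]].
  apply/even_laurentP.
  have [->|p0'] := eqVneq p' 0.
    exists (0 : fps k), 1; split=> //; rewrite ?oner_eq0 //.
    by rewrite rmorph0 !mul0r invr0 mulr0.
  exists (p * q'), (q * p'); split.
  + exact: fps_evenM.
  + exact: fps_evenM.
  + by rewrite mulf_neq0.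
  + by rewrite invf_div mulf_div !tofracM.
Qed.
HB.instance Definition _ :=
  GRing.isDivringClosed.Build (laurent k) even_laurent even_laurent_divring.

Lemma even_tofrac p : fps_even p -> p%:F \in even_laurent.
Proof.
move=> ep; apply/even_laurentP; exists p, 1; split=> //.
- by rewrite -(rmorph1 fps_const); apply: fps_even_const.
- exact: oner_neq0.
- by rewrite rmorph1 divr1.
Qed.

Lemma scal_even c : scal c \in even_laurent.
Proof. exact: even_tofrac (@fps_even_const _). Qed.

Lemma lz2_even : lz k ^+ 2 \in even_laurent.
Proof.
rewrite expr2 -tofracM; apply: even_tofrac => -[|[|[|i]]] // _.
  by rewrite fps_coefXM.
by rewrite fps_coefXM.
Qed.

Definition fps_even_part r : fps k :=
  FPS (fun i => if odd i then 0 else fps_coef r i).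

Lemma fps_even_partP r : fps_even (fps_even_part r).
Proof. by move=> i /= ->. Qed.

(** Multiplication by the even series [r] commutes with taking even parts, and the even part of the
    left-hand side is [p]. *)
Lemma fps_even_part_even p q r : fps_even p -> fps_even q -> fps_even r ->
  forall s, p + fpsX k * q = s * r -> p = fps_even_part s * r.
Proof.
move=> ep eq er s E; apply: fpsP => i.
case oi: (odd i).
  by rewrite ep // fps_evenM //; apply: fps_even_partP.
have -> : fps_coef p i = fps_coef (p + fpsX k * q) i.
  rewrite fps_coefD; case: i oi => [|i] oi; first by rewrite fps_coefXM0 addr0.
  by rewrite fps_coefXM eq ?addr0 //; move/negbFE: oi.
rewrite E !fps_coefM; apply: eq_bigr => j _ /=.
case oj: (odd j) => //.
by rewrite er ?mulr0 ?mul0r // oddB ?oi ?oj // -ltnS.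
Qed.

Fact cross_even_odd (F : fieldType) (z a b c d : F) : b != 0 -> d != 0 ->
  a * d + z * (c * b) = (a / b + z * (c / d)) * (b * d).
Proof. by move=> b0 d0; field; rewrite b0 d0. Qed.

(** Parity forbids cancellation between F and zF. Over an even common denominator, the even part of
    the equation shows that [x] is integral. *)
Lemma integral_even_odd x y : x \in even_laurent -> y \in even_laurent ->
  x + lz k * y \in integral -> x \in integral /\ y \in integral.
Proof.
move=> /even_laurentP[p [q [ep eq q0 Ex]]].
move=> /even_laurentP[p' [q' [ep' eq' q0' Ey]]] /integralP[s Es].
have xint : x \in integral.
  have E : p * q' + fpsX k * (p' * q) = s * (q * q').
    apply/eqP; rewrite -tofrac_eq; apply/eqP.
    rewrite tofracD !tofracM -Es Ex Ey.
    by apply: cross_even_odd; rewrite tofrac_eq0.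
  have := fps_even_part_even (fps_evenM ep eq') (fps_evenM ep' eq)
    (fps_evenM eq eq') E.
  rewrite mulrA => /(mulIf q0') E'.
  apply/integralP; exists (fps_even_part s).
  by rewrite Ex E' tofracM mulfK ?tofrac_eq0.
split=> //; have /integralP[r Er] : lz k * y \in integral.
  by rewrite -[lz k * y](addKr x) rpredD ?rpredN // Es integral_tofrac.
(* The series zy is integral and its even part vanishes, so it can be divided by z. *)
have r0 : fps_coef r 0 = 0.
  have E : fpsX k * p' = r * q'.
    apply/eqP; rewrite -tofrac_eq !tofracM -Er Ey; apply/eqP.
    by rewrite -mulrA divfK ?tofrac_eq0.
  have ev : fps_even (0 : fps k) by [].
  have := fps_even_part_even ev ep' eq' (etrans (add0r _) E).
  move/esym/eqP; rewrite mulf_eq0 (negbTE q0') orbF => /eqP.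
  by move/(congr1 (fun r => fps_coef r 0)).
apply/integralP; exists (FPS (fun i => fps_coef r i.+1)).
apply: (mulfI lz_neq0); rewrite Er /lz -tofracM; congr (_%:F).
by apply: fpsP => -[|i]; rewrite ?fps_coefXM0 ?fps_coefXM.
Qed.

(** Reduction modulo z, with default value 0 off k[[z]]; additivity is therefore claimed only for
    integral arguments. *)
Definition resid x : k :=
  if pselect (exists r, x = r%:F) is left H then fps_coef (projT1 (cid H)) 0
  else 0.

Lemma resid_tofrac r : resid r%:F = fps_coef r 0.
Proof.
rewrite /resid; case: pselect => [H|[]]; last by exists r.
by case: cid => r' /= /eqP; rewrite tofrac_eq => /eqP ->.
Qed.

Lemma resid0 : resid 0 = 0. Proof. by rewrite -tofrac0 resid_tofrac. Qed.

Lemma residD : {in integral &, {morph resid : x y / x + y}}.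
Proof.
move=> x y /integralP[p ->] /integralP[q ->].
by rewrite -tofracD !resid_tofrac.
Qed.

Lemma resid_scal c x : x \in integral -> resid (scal c * x) = c * resid x.
Proof.
move=> /integralP[p ->]; rewrite -tofracM !resid_tofrac.
exact: fps_coef_constM.
Qed.

Lemma resid_lz x : x \in integral -> resid (lz k * x) = 0.
Proof. by move=> /integralP[p ->]; rewrite -tofracM resid_tofrac fps_coefXM0. Qed.

Lemma resid_eq0 x : x \in integral -> resid x = 0 -> x / lz k \in integral.
Proof.
move=> /integralP[r ->]; rewrite resid_tofrac => r0.
apply/integralP; exists (FPS (fun i => fps_coef r i.+1)).
apply: (mulIf lz_neq0); rewrite divfK ?lz_neq0 // mulrC -tofracM; congr (_%:F).
by apply: fpsP => -[|i]; rewrite ?fps_coefXM0 ?fps_coefXM.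
Qed.

End Scalars.

(** * Reduction of matrices and comparison of two nested lattices *)

Section Matrices.
Variables (k : fieldType).
Local Notation O := (@integral k).
Local Notation F := (@even_laurent k).
Local Notation z := (lz k).
Local Notation scalmx := (map_mx (@scal k)).
Local Notation residmx := (map_mx (@resid k)).

Lemma scalmx_integral m n (C : 'M[k]_(m, n)) : scalmx C \is a mxOver O.
Proof. by apply/mxOverP => i j; rewrite mxE scal_integral. Qed.

Lemma scalmx_even m n (C : 'M[k]_(m, n)) : scalmx C \is a mxOver F.
Proof. by apply/mxOverP => i j; rewrite mxE scal_even. Qed.

Lemma residmxD m n (X Y : 'M[laurent k]_(m, n)) :
  X \is a mxOver O -> Y \is a mxOver O ->
  residmx (X + Y) = residmx X + residmx Y.
Proof.
by move=> /mxOverP XO /mxOverP YO; apply/matrixP => i j; rewrite !mxE residD.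
Qed.

Lemma residmx_scal m n p (C : 'M[k]_(m, n)) (Y : 'M[laurent k]_(n, p)) :
  Y \is a mxOver O -> residmx (scalmx C *m Y) = C *m residmx Y.
Proof.
move=> /mxOverP YO; apply/matrixP => i j; rewrite !mxE.
pose P x c := x \in O /\ resid x = c.
suff [] : P (\sum_l (scalmx C) i l * Y l j) (\sum_l C i l * (residmx Y) l j).
  by [].
apply: (big_ind2 P) => [|x c y d [xO <-] [yO <-]|l _]; rewrite /P.
- by rewrite rpred0 resid0.
- by rewrite rpredD ?residD.
- by rewrite !mxE rpredM ?scal_integral ?resid_scal.
Qed.

Lemma residmx_lz m n (X : 'M[laurent k]_(m, n)) :
  X \is a mxOver O -> residmx (z *: X) = 0.
Proof.
move=> /mxOverP XO; apply/matrixP => i j; rewrite !mxE.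
by rewrite resid_lz //; apply: XO.
Qed.

Lemma residmx_eq0 m n (X : 'M[laurent k]_(m, n)) :
  X \is a mxOver O -> residmx X = 0 ->
  exists2 Y, Y \is a mxOver O & X = z *: Y.
Proof.
move=> /mxOverP XO /matrixP X0; exists (z^-1 *: X); last first.
  by rewrite scalerA divff ?scale1r // lz_neq0.
apply/mxOverP => i j; rewrite mxE mulrC; apply: resid_eq0; first exact: XO.
by have := X0 i j; rewrite !mxE; exact.
Qed.

(** The columns outside [T] vanish, so [S] factors through k^T. *)
Lemma rank_le_support m n (S : 'M[k]_(m, n)) (T : {set 'I_n}) :
  (forall i j, j \notin T -> S i j = 0) -> (\rank S <= #|T|)%N.
Proof.
move=> S0; suff -> : S = colsub (@enum_val _ (mem T)) S *m
    \matrix_(a < #|T|, j < n) (enum_val a == j)%:R.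
  exact: leq_trans (mxrankM_maxr _ _) (rank_leq_row _).
apply/matrixP => i j; rewrite mxE.
have [jT|jT] := boolP (j \in T).
  rewrite (bigD1 (enum_rank_in jT j)) //= !mxE enum_rankK_in // eqxx mulr1.
  rewrite big1 ?addr0 // => a ne_a; rewrite !mxE.
  case: eqP => [E|_]; last by rewrite mulr0.
  by rewrite -(enum_valK_in jT a) E eqxx in ne_a.
rewrite S0 // big1 // => a _; rewrite !mxE.
case: eqP => [E|_]; last by rewrite mulr0.
by case/negP: jT; rewrite -E enum_valP.
Qed.

(* A matrix [G], the transpose of a g as above, stands for the lattice of the row
   vectors [x] such that [x *m G] is integral; [near_even_odd m G] consists of
   the reductions of the vectors [z *: q] of Y_m. *)
Definition near_even_odd n (m : nat) (G : 'M[laurent k]_n) (s : 'rV[k]_n) :=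
  exists q p W : 'rV[laurent k]_n,
    [/\ q \is a mxOver F, p \is a mxOver F, W \is a mxOver O,
        (z *: q *m G \is a mxOver O) &
        (z *: q - p) *m G = z ^+ m *: W /\ s = residmx (z *: q *m G)].

(** The rows of [P] and [z *: Q] are the vectors p and q of the outline, congruent modulo z^m, the
    p's being independent modulo z. *)
Definition near_even_odd_family n (m r : nat) (G : 'M[laurent k]_n) :=
  exists (P Q : 'M[laurent k]_(r, n)) (W : 'M[laurent k]_(r, n)),
    [/\ P \is a mxOver F, Q \is a mxOver F, W \is a mxOver O,
        P *m G \is a mxOver O &
        (z *: Q - P) *m G = z ^+ m *: W /\ row_free (residmx (P *m G))].

(** The lattice of [z *: G] is z^-1 times that of [G], and (p, q) becomes (q/z, p/z). Since the
    exponent [m.+1] is positive, p and q have the same reduction, so independence survives. *)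
Lemma near_even_odd_family_lz n m r (G : 'M[laurent k]_n) :
  near_even_odd_family m.+1 r G -> near_even_odd_family m.+1 r (z *: G).
Proof.
move=> [P [Q [W [PF QF WO PGO [QPG free]]]]].
have QGE : Q *m (z *: G) = P *m G + z *: (z ^+ m *: W).
  rewrite -scalemxAr scalemxAl scalerA -exprS -QPG mulmxBl addrC subrK //.
have WmO : z ^+ m *: W \is a mxOver O.
  by rewrite mxOverZ // rpredX // lz_integral.
have WzO : z *: (z ^+ m *: W) \is a mxOver O by rewrite mxOverZ // lz_integral.
exists Q, (z ^- 2 *: P), (- W); split; rewrite ?rpredN //.
- by rewrite mxOverZ // rpredV lz2_even.
- by rewrite QGE rpredD.
split; last by rewrite QGE residmxD // residmx_lz // addr0.
rewrite -scalemxAr scalemxAl scalerBr !scalerA -opprB.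
rewrite -expr2 divff ?expf_neq0 ?lz_neq0 //.
by rewrite scale1r mulNmx QPG scalerN.
Qed.

(** With L and M the lattices of [G] and [G'], the equations on [A] and [A'] say zM <= L <= M. The
    proof exhibits r independent reductions of elements of Y_m(L), all supported on [T]. *)
Lemma near_even_odd_transfer n m r (G G' A A' : 'M[laurent k]_n) (T : {set 'I_n}) :
  A \is a mxOver O -> A' \is a mxOver O -> G' = G *m A -> z *: G = G' *m A' ->
  near_even_odd_family m.+1 r G' ->
  (forall s, near_even_odd m G s -> forall i, i \notin T -> s 0 i = 0) ->
  (r <= #|T|)%N.
Proof.
move=> AO A'O G'E zGE [P [Q [W [PF QF WO PGO [QPG free]]]]] sT.
have z0 := lz_neq0 k; have zO := lz_integral k.
have zPGE : z *: P *m G = P *m G' *m A'.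
  by rewrite -scalemxAl scalemxAr zGE mulmxA.
have zPGO : z *: P *m G \is a mxOver O by rewrite zPGE mxOverM.
(* Passing from M to L costs one power of z in the congruence. *)
have QPG1 : (z *: Q - P) *m G = z ^+ m *: (W *m A').
  apply: (scalerI z0); rewrite scalemxAr zGE mulmxA QPG.
  by rewrite -scalemxAl scalerA -exprS.
have QG'E : z *: Q *m G' = P *m G' + z ^+ m.+1 *: W.
  by rewrite -QPG mulmxBl addrC subrK.
have zmO : z ^+ m \in O by rewrite rpredX.
(* The kernel of [R] consists of the c for which p_c lies in L. *)
set R := residmx (z *: P *m G).
have [K Kfree KR] : exists2 K : 'M_(\rank (kermx R), r), row_free K & K *m R = 0.
  exists (row_base (kermx R)); first exact: row_base_free.
  by apply/sub_kermxP; rewrite eq_row_base.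
(* If p_D lies in L then so does q_D, which differs from it by an element of z^m L. *)
have kerO p (D : 'M[k]_(p, r)) : D *m R = 0 ->
    z *: (scalmx D *m Q) *m G \is a mxOver O.
  move=> DR; have XO : scalmx D *m (z *: P *m G) \is a mxOver O.
    by rewrite mxOverM // scalmx_integral.
  have [|Y YO YE] := residmx_eq0 XO; first by rewrite residmx_scal.
  have E : scalmx D *m P *m G = Y.
    by apply: (scalerI z0); rewrite -YE -!scalemxAl -scalemxAr mulmxA.
  have -> : z *: (scalmx D *m Q) *m G =
      scalmx D *m P *m G + z ^+ m *: (scalmx D *m (W *m A')).
    by rewrite [in LHS]scalemxAr [in RHS]scalemxAr -QPG1 [in RHS]mulmxA -mulmxDl
      -mulmxDr [P + _]addrC subrK.
  rewrite E rpredD // mxOverZ // mxOverM ?scalmx_integral //.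
  by rewrite mxOverM.
(* The rows are a basis of the reductions of the z p_c, followed by the reductions of q_d for d in a
   basis of the kernel: r rows in all. *)
pose S := col_mx (row_base R) (residmx (z *: (scalmx K *m Q) *m G)).
have vS (v : 'rV_(\rank R + \rank (kermx R))) : exists2 c : 'rV_r,
    lsubmx v *m row_base R = c *m R &
    v *m S = c *m R + residmx (z *: (scalmx (rsubmx v *m K) *m Q) *m G).
  have /submxP[c Ec] : (lsubmx v *m row_base R <= R)%MS.
    by apply: submx_trans (submxMl _ _) _; rewrite eq_row_base.
  exists c => //; rewrite -{1}[v]hsubmxK mul_row_col Ec; congr (_ + _).
  rewrite -residmx_scal ?kerO //; congr (residmx _).
  by rewrite map_mxM -[scalmx _ *m scalmx _ *m Q]mulmxA [in RHS]scalemxAr mulmxA.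
pose X c d : 'rV[laurent k]_n := z *: (scalmx c *m P + scalmx d *m Q) *m G.
have XE c d : X c d = scalmx c *m (z *: P *m G) + z *: (scalmx d *m Q) *m G.
  by rewrite /X scalerDr mulmxDl [z *: (_ *m P)]scalemxAr mulmxA.
have cPO c : scalmx c *m (z *: P *m G) \is a @mxOver 1 _ _ O.
  by rewrite mxOverM // scalmx_integral.
have XO c d : d *m R = 0 -> X c d \is a mxOver O.
  by move=> dR; rewrite XE rpredD ?cPO ?kerO.
have residX c d : d *m R = 0 ->
    residmx (X c d) = c *m R + residmx (z *: (scalmx d *m Q) *m G).
  by move=> dR; rewrite XE residmxD ?cPO ?kerO ?residmx_scal.
have vK0 v : (v *m K) *m R = 0 :> 'rV_n by rewrite -mulmxA KR mulmx0.
have Sfree : row_free S.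
  apply: inj_row_free => v vS0; have [c Ec] := vS v.
  rewrite vS0 -residX // => /esym X0; set d := rsubmx v *m K in X0.
  have dR : d *m R = 0 by apply: vK0.
  have [Y YO YE] := residmx_eq0 (XO c d dR) X0.
  (* Here z p_c + q_d lies in zL, hence in zM. As p_c is in M and q_d is congruent to p_d modulo zM,
     the reduction of p_d in M/zM is zero, and independence gives d = 0. *)
  have d0 : d = 0.
    apply/eqP; rewrite -(mulmx_free_eq0 _ free) -residmx_scal //.
    have -> : scalmx d *m (P *m G') =
        z *: (Y *m A - scalmx c *m (P *m G') - z ^+ m *: (scalmx d *m W)).
      rewrite !scalerBr scalerA -exprS [z *: (Y *m A)]scalemxAl -YE -[X c d *m A]mulmxA.
      rewrite -G'E /X scalerDr mulmxDl [z *: (_ *m Q)]scalemxAr.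
      rewrite -[_ *m (z *: Q) *m G']mulmxA.
      rewrite QG'E mulmxDr -[_ *m (z ^+ m.+1 *: W)]scalemxAr [scalmx c *m (_ *m _)]mulmxA.
      by rewrite [z *: (_ *m G')]scalemxAl [X in X - _ - _]addrC !addrK.
    rewrite residmx_lz //.
    apply: rpredB; last by rewrite mxOverZ // mxOverM ?scalmx_integral.
    by apply: rpredB; rewrite mxOverM ?scalmx_integral.
  have v2 : rsubmx v = 0.
    by apply/eqP; rewrite -(mulmx_free_eq0 _ Kfree) -/d d0.
  have v1 : lsubmx v = 0.
    apply/eqP; rewrite -(mulmx_free_eq0 _ (row_base_free R)).
    move: vS0; rewrite -{1}[v]hsubmxK mul_row_col v2 mul0mx addr0.
    by move=> ->.
  by rewrite -[v]hsubmxK v1 v2 row_mx0.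
have <- : (\rank R + \rank (kermx R) = r)%N.
  by rewrite mxrank_ker subnKC // rank_leq_row.
move: Sfree; rewrite /row_free => /eqP <-.
apply: rank_le_support => i j jT.
have -> : S i j = row i S 0 j by rewrite [RHS]mxE.
apply: sT jT; rewrite rowE; have [c _ ->] := vS (delta_mx 0 i).
set d := rsubmx _ *m K; have dR : d *m R = 0 by apply: vK0.
(* The vector z p_c + q_d of zF^n is close to z q_c + p_d, which lies in F^n because z q_c is z^2
   times a vector of F^n. *)
exists (scalmx c *m P + scalmx d *m Q), (z ^+ 2 *: (scalmx c *m Q) + scalmx d *m P).
exists (scalmx d *m (W *m A') - z *: (scalmx c *m (W *m A'))); split.
- by rewrite rpredD // mxOverM ?scalmx_even.
- by rewrite rpredD ?mxOverZ ?lz2_even // mxOverM ?scalmx_even.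
- by rewrite rpredB ?mxOverZ // !mxOverM ?scalmx_integral.
- exact: XO.
split; last by rewrite -residX.
rewrite scalerBr [z ^+ m *: (z *: _)]scalerA [_ * z]mulrC.
rewrite -[_ *: (scalmx c *m (W *m A'))]scalerA.
rewrite [z ^+ m *: (scalmx c *m _)]scalemxAr [z ^+ m *: (_ *m _)]scalemxAr -QPG1.
rewrite !mulmxA [z *: (_ *m G)]scalemxAl -mulmxBl; congr (_ *m G).
rewrite !mulmxBr scalerBr scalerDr opprD opprB expr2 -scalerA.
rewrite [z *: (scalmx c *m Q)]scalemxAr [z *: (scalmx d *m Q)]scalemxAr.
by rewrite [X in X + _]addrC [- _ - _]addrC addrACA.
Qed.

End Matrices.

(** * The lattice of a block diagonal model *)

Section Model.
Variables (k : fieldType) (n : nat).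
Local Notation O := (@integral k).
Local Notation F := (@even_laurent k).
Local Notation z := (lz k).

(* The block diagonal matrix in which the indices [t j] and [j] carry a block
   [1, z; 0, z^(e j)] when [2 <= e j], and the other ones carry (1) or (z). *)
Definition sym_model (e : 'I_n -> nat) (t : 'I_n -> 'I_n) : 'M[laurent k]_n :=
  \matrix_(i, j) (z ^+ e i *+ (i == j) + z *+ ((1 < e j)%N && (t j == i))).

Variables (e : 'I_n -> nat) (t : 'I_n -> 'I_n).
Hypothesis t_inj : {in [pred j | (1 < e j)%N] &, injective t}.
Hypothesis et : forall j, (1 < e j)%N -> e (t j) = 0%N.

Local Notation G := (sym_model e t)^T.

Lemma mul_sym_modelE (x : 'rV_n) i :
  (x *m G) 0 i = z ^+ e i * x 0 i + \sum_(j | (1 < e j)%N && (t j == i)) z * x 0 j.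
Proof.
rewrite mxE; under eq_bigr => j _ do rewrite !mxE mulrDr.
rewrite big_split; congr (_ + _).
  rewrite (bigD1 i) //= eqxx mulr1n mulrC big1 ?addr0 // => j /negbTE ji.
  by rewrite eq_sym ji mulr0n mulr0.
rewrite [RHS]big_mkcond; apply: eq_bigr => j _.
by case: ifP => _; rewrite ?mulr1n ?mulr0n ?mulr0 // mulrC.
Qed.

Lemma mul_sym_model_diag (x : 'rV_n) i :
  (forall j, (1 < e j)%N -> t j != i) -> (x *m G) 0 i = z ^+ e i * x 0 i.
Proof.
move=> ti; rewrite mul_sym_modelE big_pred0 ?addr0 // => j.
by case ej: (1 < e j)%N => //=; apply/negbTE/ti.
Qed.

Lemma mul_sym_model_U (x : 'rV_n) j : (1 < e j)%N ->
  (x *m G) 0 (t j) = x 0 (t j) + z * x 0 j.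
Proof.
move=> ej; rewrite mul_sym_modelE et // expr0 mul1r; congr (_ + _).
rewrite (bigD1 j) ?ej ?eqxx //= big1 ?addr0 // => l /andP[/andP[el /eqP tl]].
by rewrite (t_inj _ _ tl) ?eqxx.
Qed.

Definition sym_partner i :=
  if [pick j | (1 < e j)%N && (t j == i)] is Some j then j else i.
(** One index per block of exponent above m: the first index of a 2 by 2 block, or the index of a
    block (z), which occurs only for m = 0. *)
Definition sym_support m := [set i | (e i <= 1)%N && (m < e (sym_partner i))%N].

(** [sym_partner] is injective on the support: the condition [e i <= 1] excludes the second indices
    of the 2 by 2 blocks. *)
Lemma card_sym_model_support m : (#|sym_support m| <= #|[set j | (m < e j)%N]|)%N.
Proof.
rewrite -(@card_in_imset _ _ sym_partner (sym_support m)).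
  apply/subset_leq_card/subsetP => j /imsetP[i iS ->].
  by move: iS; rewrite !inE => /andP[].
move=> i i'; rewrite !inE /sym_partner => /andP[ei _] /andP[ei' _].
case: pickP => [j /andP[ej /eqP <-]|_]; case: pickP => [j' /andP[ej' /eqP <-]|_] //.
- by move=> ->.
- by move=> E; rewrite -E leqNgt ej in ei'.
- by move=> E; rewrite E leqNgt ej' in ei.
Qed.

(** An integral element of zF has no constant term. *)
Lemma integral_odd (x : laurent k) : x \in F -> z * x \in O -> x \in O.
Proof.
by move=> xF zxO; have [|_ ->] := integral_even_odd (rpred0 F) xF; rewrite ?add0r.
Qed.

Lemma resid_lzX m (x : laurent k) : (0 < m)%N -> x \in O -> resid (z ^+ m * x) = 0.
Proof.
by case: m => // m _ xO; rewrite exprS -mulrA resid_lz // rpredM ?rpredX ?lz_integral.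
Qed.

Lemma integral_lz_factor m d (x y : laurent k) :
  (d <= m)%N -> z ^+ d * x = z ^+ m * y -> y \in O -> x \in O.
Proof.
move=> dm E yO; suff -> : x = z ^+ (m - d) * y by rewrite rpredM ?rpredX ?lz_integral.
have z0 : z ^+ d != 0 by rewrite expf_neq0 ?lz_neq0.
by apply: (mulfI z0); rewrite E mulrA -exprD subnKC.
Qed.

Lemma near_even_odd_support m s i :
  near_even_odd m G s -> i \notin sym_support m -> s 0 i = 0.
Proof.
move=> [q [p [W [/mxOverP qF /mxOverP pF /mxOverP WO /mxOverP qO [qp ->]]]]].
have qj j : q 0 j \in F by apply: qF.
have pj j : p 0 j \in F by apply: pF.
have zq2 j : z * (z * q 0 j) \in F.
  by rewrite mulrA -expr2; apply: rpredM; [apply: lz2_even | apply: qj].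
have yO j : (z *: q *m G) 0 j \in O by apply: qO.
have Wj j : W 0 j \in O by apply: WO.
have diff j : (z *: q *m G) 0 j - (p *m G) 0 j = z ^+ m * W 0 j.
  by have /matrixP/(_ 0 j) := qp; rewrite mulmxBl !mxE.
have noU j : (0 < e j)%N -> forall l, (1 < e l)%N -> t l != j.
  by move=> ej l el; apply: contraTneq ej => <-; rewrite et.
(* Coordinate [t j] of the integral vector is z^2 q_j + z q_(t j), the sum of an even and an odd
   term, which are split by parity. *)
have Uq j : (1 < e j)%N -> z * (z * q 0 j) \in O /\ q 0 (t j) \in O.
  move=> ej; apply: integral_even_odd; [exact: zq2 | exact: qj |].
  by rewrite addrC; have := yO (t j); rewrite mul_sym_model_U // !mxE.
rewrite inE negb_and -ltnNge -leqNgt mxE /sym_partner => /orP[ei|].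
  (* At the second index of a block the coordinate is z^(e i - 1) times the integral z^2 q_i, with a
     positive exponent. *)
  rewrite mul_sym_model_diag; last by apply/noU/ltnW.
  rewrite -(ltn_predK ei) exprSr -mulrA mxE resid_lzX ?(proj1 (Uq _ _)) //.
  by rewrite -ltnS (ltn_predK ei).
case: pickP => [j /andP[ej /eqP <-]|none].
  (* As e j <= m, coordinate j of the congruence can be divided by z^(e j): z q_j - p_j is integral,
     hence so is q_j by parity, and coordinate [t j] is z times an integral element. *)
  move=> em; have noj := noU j (ltnW ej).
  have : z ^+ e j * (z * q 0 j - p 0 j) = z ^+ m * W 0 j.
    by rewrite -(diff j) !mul_sym_model_diag // mxE mulrBr.
  move=> /(integral_lz_factor em)/(_ (Wj j)).
  rewrite addrC => zqpO; have [||_ qO'] := integral_even_odd _ _ zqpO.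
  - by rewrite rpredN; apply: pj.
  - exact: qj.
  rewrite mul_sym_model_U // !mxE -mulrDr resid_lz // rpredD ?rpredM ?lz_integral //.
  by have [] := Uq _ ej.
have noU' j : (1 < e j)%N -> t j != i.
  by move=> ej; have := none j; rewrite ej => /negbT.
rewrite mul_sym_model_diag // mxE => em.
suff qiO : q 0 i \in O by rewrite mulrCA resid_lz // rpredM ?rpredX ?lz_integral.
(* For exponent 0 the coordinate z q_i is itself integral; otherwise the congruence is divided by
   z^(e i) as before. *)
have [ei0|ei] := posnP (e i).
  apply: integral_odd => //.
  by have := yO i; rewrite mul_sym_model_diag // ei0 expr0 mul1r mxE.
have := diff i; rewrite !mul_sym_model_diag // mxE -mulrBr.
move=> /(integral_lz_factor em)/(_ (Wj i)).
rewrite addrC => zqpO; have [||_ //] := integral_even_odd _ _ zqpO.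
- by rewrite rpredN; apply: pj.
- exact: qj.
Qed.

(** For a block of exponent e at the indices [t j], j, take for p the unit vector at [t j] and for q
    the unit vector at j divided by z. Their images under [G] differ by z^(e - 1) at j, and e - 1 =
    (m + 1) + (e - m - 2). Injectivity of [t] makes the p's independent. *)
Lemma near_even_odd_family_sym_model m :
  near_even_odd_family m.+1 #|[set j | (m.+1 < e j)%N]| G.
Proof.
set J := [set _ | _].
have Je (a : 'I_#|J|) : (m.+1 < e (enum_val a))%N.
  by have := enum_valP a; rewrite inE.
have Je1 (a : 'I_#|J|) : (1 < e (enum_val a))%N by apply: leq_trans (Je a).
exists (\matrix_(a, i) ((t (enum_val a) == i)%:R)).
exists (\matrix_(a, i) (z ^- 2 *+ (enum_val a == i))).
exists (\matrix_(a, i) (z ^+ (e (enum_val a) - m.+2) *+ (enum_val a == i))).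
have PG : (\matrix_(a, i) ((t (enum_val a) == i)%:R)) *m G =
    \matrix_(a < #|J|, i < n) ((t (enum_val a) == i)%:R).
  apply/matrixP => a i.
  have -> : (\matrix_(a < #|J|, i < n) ((t (enum_val a) == i)%:R) *m G) a i =
     ((\row_i ((t (enum_val a) == i)%:R) : 'rV_n) *m G) 0 i.
    by rewrite !mxE; apply: eq_bigr => l _; rewrite !mxE.
  rewrite mul_sym_modelE !mxE big1 ?addr0.
    by case: eqP => [<-|]; rewrite ?et ?mulr1 ?mulr0.
  move=> j /andP[ej _]; rewrite mxE; case: eqP => [E|_]; last by rewrite mulr0.
  by rewrite -E et in ej.
split.
- by apply/mxOverP => a i; rewrite mxE rpred_nat.
- by apply/mxOverP => a i; rewrite mxE rpredMn // rpredV lz2_even.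
- by apply/mxOverP => a i; rewrite mxE rpredMn // rpredX // lz_integral.
- by rewrite PG; apply/mxOverP => a i; rewrite mxE rpred_nat.
split.
  rewrite mulmxBl PG; apply/matrixP => a i; rewrite [LHS]mxE.
  have -> : (z *: \matrix_(a < #|J|, i < n) (z ^- 2 *+ (enum_val a == i)) *m G) a i =
     ((\row_i (z^-1 *+ (enum_val a == i)) : 'rV_n) *m G) 0 i.
    rewrite !mxE; apply: eq_bigr => l _; rewrite !mxE mulrnAr; congr (_ *+ _ * _).
    by rewrite expr2 invfM mulrA divff ?mul1r // lz_neq0.
  rewrite mul_sym_modelE !mxE.
  have [<-{i}|ne] := eqVneq (enum_val a) i.
    rewrite big1 ?addr0 => [|j /andP[ej /eqP tj]]; last first.
      by have := Je1 a; rewrite -tj et.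
    have /negbTE -> : t (enum_val a) != enum_val a.
      by apply: contraTneq (Je1 a) => <-; rewrite et.
    rewrite mulr1n mulr0n subr0 -exprD.
    have -> : (m.+1 + (e (enum_val a) - m.+2) = (e (enum_val a)).-1)%N.
      by have := Je a; lia.
    by rewrite -{1}(ltn_predK (Je a)) exprSr mulfK ?lz_neq0.
  rewrite !mulr0n !mulr0 add0r.
  have [<-{i ne}|ne'] := eqVneq (t (enum_val a)) i.
    rewrite (bigD1 (enum_val a)) ?Je1 ?eqxx //= mxE eqxx divff ?lz_neq0 //.
    rewrite big1 ?addr0 ?subrr // => j /andP[_ /negbTE ja].
    by rewrite mxE eq_sym ja mulr0.
  rewrite subr0 big1 // => j /andP[_ /eqP tj]; rewrite mxE.
  by case: eqP => [aj|_]; [rewrite aj tj eqxx in ne' | rewrite mulr0].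
rewrite PG; apply/row_freeP.
exists (\matrix_(i, a) ((t (enum_val a) == i)%:R)).
apply/matrixP => a b; rewrite !mxE (bigD1 (t (enum_val a))) //= !mxE eqxx.
rewrite [resid _](resid_tofrac 1) mul1r big1 ?addr0 => [|i ne]; last first.
  by rewrite !mxE eq_sym (negbTE ne) resid0 mul0r.
by rewrite (inj_in_eq t_inj) ?inE ?Je1 // (inj_eq enum_val_inj) eq_sym.
Qed.

End Model.

(** * From lists of blocks to the indexed model *)

Section Blocks.
Variable k : fieldType.
Implicit Types b : sym_block.

Definition sym_exponent b (j : nat) : nat :=
  match b with
  | Block1 => 0
  | Blockz => 1
  | BlockU i => if j == 0%N then 0 else i
  end.

Lemma sym_exponent_gt1 b j :
  (j < sym_block_size b)%N -> (1 < sym_exponent b j)%N -> j = 1%N.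
Proof. by case: b => [||d] //=; case: j => [|[|]]. Qed.

Lemma sym_exponent_gt1_0 b j :
  (1 < sym_exponent b j)%N -> sym_exponent b 0 = 0%N.
Proof. by case: b. Qed.

(** [sym_block_ok] makes the test on the exponent recognise exactly the second column of a
    [BlockU]. *)
Lemma sym_block_mxE b (i j : 'I_(sym_block_size b)) : sym_block_ok b ->
  sym_block_mx k b i j = lz k ^+ sym_exponent b i *+ (i == j)
    + lz k *+ ((1 < sym_exponent b j)%N && (i == 0 :> nat)).
Proof.
case: b i j => [||d] /= i j d1.
- by rewrite !ord1 !mxE mulr0n addr0 expr0.
- by rewrite !ord1 !mxE mulr0n addr0 expr1.
- case: (@split_ordP 1 1 i) => {}i ->; case: (@split_ordP 1 1 j) => {}j ->.
  all: rewrite !ord1.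
  + by rewrite [X in X = _]block_mxEul mxE mulr0n addr0 expr0 !eqxx.
  + by rewrite [X in X = _]block_mxEur mxE /= d1 mulr0n add0r.
  + by rewrite [X in X = _]block_mxEdl mxE /= !mulr0n addr0.
  + by rewrite [X in X = _]block_mxEdr mxE /= andbF mulr0n addr0.
Qed.

Lemma count_sym_block_coweight b (p : pred int) :
  count p (sym_block_coweight b) =
  (\sum_(j < sym_block_size b) p (sym_exponent b j)%:Z)%N.
Proof.
case: b => [||i] /=; rewrite ?big_ord1 ?addn0 //.
by rewrite big_ord_recl big_ord1 /= addnC.
Qed.

(** [tagnat] decodes a flat index into a block and a position in it; [t] sends an index to the first
    one of its block, the row that holds the off-diagonal z. *)
Lemma sym_blocks_model (bs : seq sym_block) n (en : sym_blocks_size bs = n) :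
  all sym_block_ok bs ->
  exists (e : 'I_n -> nat) (t : 'I_n -> 'I_n),
    [/\ {in [pred j | (1 < e j)%N] &, injective t},
        forall j, (1 < e j)%N -> e (t j) = 0%N,
        castmx (en, en) (sym_blocks_mx k bs) = sym_model k e t &
        forall p : pred int,
          count p (flatten [seq sym_block_coweight b | b <- bs]) =
          #|[set j | p (e j)%:Z]|].
Proof.
case: _ / en => all_ok; rewrite castmx_id.
pose B := tnth (in_tuple bs).
have ok i : sym_block_ok (B i) by apply: (elimT (@all_tnthP _ _ _ (in_tuple bs))).
have sz0 b : (0 < sym_block_size b)%N by case: b.
pose Rank := @tagnat.Rank _ (fun i => sym_block_size (B i)).
pose e (s : 'I_(sym_blocks_size bs)) : nat :=
  sym_exponent (B (tagnat.sig1 s)) (tagnat.sig2 s).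
pose t (s : 'I_(sym_blocks_size bs)) : 'I_(sym_blocks_size bs) :=
  Rank _ (Ordinal (sz0 (B (tagnat.sig1 s)))).
have eR i (j : 'I_(sym_block_size (B i))) :
    e (Rank i j) = sym_exponent (B i) j.
  by rewrite /e tagnat.Rank2K /= tagnat.Rank1K.
have tR i (j : 'I_(sym_block_size (B i))) :
    t (Rank i j) = Rank i (Ordinal (sz0 (B i))).
  by apply: val_inj; apply/eqP; rewrite /t tagnat.eq_Rank tagnat.Rank1K !eqxx.
have eqR i i' (j : 'I_(sym_block_size (B i))) (j' : 'I_(sym_block_size (B i'))) :
    (Rank i j == Rank i' j') = (i == i') && (j == j' :> nat).
  by rewrite -val_eqE /= tagnat.eq_Rank.
exists e, t; split.
- move=> s s'; rewrite -[s]tagnat.sig2K -[s']tagnat.sig2K !inE !eR !tR.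
  move: (tagnat.sig1 s) (tagnat.sig1 s') (tagnat.sig2 s) (tagnat.sig2 s').
  move=> i i' j j' ej ej' /eqP; rewrite eqR => /andP[/eqP ii' _].
  apply/eqP; rewrite eqR; case: _ / ii' in j' ej' *; rewrite eqxx /=.
  by rewrite (sym_exponent_gt1 (ltn_ord j) ej) (sym_exponent_gt1 (ltn_ord j') ej').
- move=> s; rewrite -[s]tagnat.sig2K eR tR eR.
  exact: sym_exponent_gt1_0.
- apply/matrixP => s s'; rewrite -[s]tagnat.sig2K -[s']tagnat.sig2K.
  move: (tagnat.sig1 s) (tagnat.sig1 s') (tagnat.sig2 s) (tagnat.sig2 s').
  move=> i i' j j'; rewrite [RHS]mxE !eR tR !eqR.
  transitivity (submxblock (sym_blocks_mx k bs) i i' j j'); first by rewrite [RHS]mxE.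
  rewrite mxblockK; have [ii'|ne] := eqVneq i i'; last first.
    by rewrite mxE andbF addr0.
  case: _ / ii' in j' *.
  by rewrite conform_mx_id sym_block_mxE ?eqxx ?[0%N == _]eq_sym //; apply: ok.
- move=> p; rewrite count_flatten sumnE -map_comp big_map big_tnth.
  under eq_bigr do rewrite /= count_sym_block_coweight.
  rewrite sig_big_dep /= (reindex _ tagnat.sig_bij_on) /= -sum1_card big_mkcond /=.
  by rewrite [RHS]big_mkcond; apply: eq_bigr => s _; rewrite inE /e; case: p.
Qed.

Lemma symmetric_coweight_model n (g : 'M[laurent k]_n) (a : n.-tuple int) :
  symmetric_coweight g a ->
  exists (e : 'I_n -> nat) (t : 'I_n -> 'I_n) (u h : 'M[laurent k]_n),
    [/\ {in [pred j | (1 < e j)%N] &, injective t},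
        forall j, (1 < e j)%N -> e (t j) = 0%N,
        [/\ in_K u, in_H h & g = u *m sym_model k e t *m h],
        sorted >=%R a &
        forall p : pred int, count p a = #|[set j | p (e j)%:Z]|].
Proof.
move=> [bs [en [u [h [ok uK hH -> aE]]]]].
have [e [t [t_inj et -> cnt]]] := sym_blocks_model en ok.
exists e, t, u, h; split=> // [|p]; rewrite aE.
  by apply: sort_sorted => x y; rewrite /= le_total.
by rewrite -cnt; apply/permP; rewrite perm_sort.
Qed.

End Blocks.

(** * Double cosets and comparison of exponents *)

Section Cosets.
Variables (k : fieldType) (n : nat).
Local Notation O := (@integral k).
Local Notation F := (@even_laurent k).
Local Notation z := (lz k).
Implicit Types (g u h : 'M[laurent k]_n).

Lemma in_K_inverse u : in_K u ->
  u \is a mxOver O /\ exists2 v, v \is a mxOver O & v *m u = 1%:M.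
Proof.
move=> [w w_unit ->]; split; first by apply/mxOverP => i j; rewrite mxE integral_tofrac.
exists (map_mx (@tofrac (fps k)) (invmx w)).
  by apply/mxOverP => i j; rewrite mxE integral_tofrac.
by rewrite -map_mxM mulVmx // map_mx1.
Qed.

Lemma det_even p (M : 'M[laurent k]_p) : M \is a mxOver F -> \det M \in F.
Proof.
move=> /mxOverP MF; apply: rpred_sum => s _; apply: rpredM.
  by apply: rpredX; rewrite rpredN rpred1.
by apply: rpred_prod => i _; apply: MF.
Qed.

(** Cramer's formula; for singular [M], [invmx M] is [M] itself. *)
Lemma invmx_even M : M \is a @mxOver n n _ F -> invmx M \is a mxOver F.
Proof.
move=> MF; rewrite /invmx; case: ifP => // _.
rewrite mxOverZ ?rpredV ?det_even //; apply/mxOverP => i j; rewrite mxE.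
apply: rpredM; first by apply: rpredX; rewrite rpredN rpred1.
apply: det_even; apply/mxOverP => i' j'; rewrite !mxE.
by move/mxOverP: MF; apply.
Qed.

(** Multiplication by [M] preserves F^n and zF^n. It serves to remove the transposed factor from
    H. *)
Lemma near_even_odd_mull m (M G : 'M[laurent k]_n) s :
  M \is a mxOver F -> near_even_odd m (M *m G) s -> near_even_odd m G s.
Proof.
move=> MF [q [p [W [qF pF WO qO [qp ->]]]]].
exists (q *m M), (p *m M), W.
have E : z *: (q *m M) *m G = z *: q *m (M *m G) by rewrite scalemxAl mulmxA.
rewrite E; split=> //; [exact: mxOverM | exact: mxOverM |].
by split=> //; rewrite mulmxBl E -mulmxA -mulmxBl.
Qed.

Lemma near_even_odd_family_mull m r (M G : 'M[laurent k]_n) :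
  M \in unitmx -> M \is a mxOver F ->
  near_even_odd_family m r G -> near_even_odd_family m r (M *m G).
Proof.
move=> uM MF [P [Q [W [PF QF WO PO [PQ free]]]]].
exists (P *m invmx M), (Q *m invmx M), W.
have E (X : 'M_(r, n)) : X *m invmx M *m (M *m G) = X *m G by rewrite mulmxA mulmxKV.
rewrite E; split=> //; try by apply: mxOverM => //; apply: invmx_even.
by rewrite scalemxAl -mulmxBl E.
Qed.

(** With g_i the product of the i-th model and [h_i], the transfer is applied to (M, L) = (L(g_1's
    multiple g_2), L(g_1)), that is to (L(g_2), L(g_1)), and then to (z^-1 L(g_1), L(g_2)). *)
Lemma model_exponent_le m (e1 e2 : 'I_n -> nat) t1 t2 h1 h2 C C' :
  {in [pred j | (1 < e1 j)%N] &, injective t1} ->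
  (forall j, (1 < e1 j)%N -> e1 (t1 j) = 0%N) ->
  {in [pred j | (1 < e2 j)%N] &, injective t2} ->
  (forall j, (1 < e2 j)%N -> e2 (t2 j) = 0%N) ->
  in_H h1 -> in_H h2 -> C \is a mxOver O -> C' \is a mxOver O ->
  C *m (sym_model k e1 t1 *m h1) = sym_model k e2 t2 *m h2 ->
  C' *m (sym_model k e2 t2 *m h2) = z *: (sym_model k e1 t1 *m h1) ->
  (#|[set j | (m.+1 < e2 j)%N]| <= #|[set j | (m < e1 j)%N]|)%N /\
  (#|[set j | (m.+1 < e1 j)%N]| <= #|[set j | (m < e2 j)%N]|)%N.
Proof.
move=> t1_inj et1 t2_inj et2 [uh1 h1F] [uh2 h2F] CO C'O.
have HF h : (forall i j, in_laurent_z2 (h i j)) -> h^T \is a mxOver F.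
  by move=> hF; apply/mxOverP => i j; rewrite mxE; apply/even_laurentP.
have trO M : M \is a mxOver O -> M^T \is a @mxOver n n _ O.
  by move=> /mxOverP MO; apply/mxOverP => i j; rewrite mxE.
move=> /(congr1 trmx); rewrite !trmx_mul => E1.
move=> /(congr1 trmx); rewrite linearZ /= !trmx_mul => E2.
have uT h : h \in unitmx -> h^T \in unitmx by rewrite unitmx_tr.
split.
  apply: leq_trans (card_sym_model_support e1 t1 m).
  apply: (near_even_odd_transfer (trO _ CO) (trO _ C'O) (esym E1) (esym E2)).
    apply: near_even_odd_family_mull (uT _ uh2) (HF _ h2F) _.
    exact: near_even_odd_family_sym_model.
  move=> s /(near_even_odd_mull (HF _ h1F)) ns i.
  exact: near_even_odd_support ns.
apply: leq_trans (card_sym_model_support e2 t2 m).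
apply: (near_even_odd_transfer (G := h2^T *m (sym_model k e2 t2)^T)
  (G' := z *: (h1^T *m (sym_model k e1 t1)^T))
  (trO _ C'O) (trO _ CO)).
- by rewrite E2.
- by rewrite -scalemxAl E1.
- apply: near_even_odd_family_lz.
  apply: near_even_odd_family_mull (uT _ uh1) (HF _ h1F) _.
  exact: near_even_odd_family_sym_model.
move=> s /(near_even_odd_mull (HF _ h2F)) ns i.
exact: near_even_odd_support ns.
Qed.

(** [A'] is z times the inverse of [A]: the diagonal entries z and 1 are exchanged, so it stays
    integral. *)
Lemma minuscule_integral l A :
  dominant_coweight A [tuple (if (i < l)%N then 1 else 0) | i < n] ->
  A \is a mxOver O /\ exists2 A', A' \is a mxOver O & A' *m A = z%:M.
Proof.
move=> [_ [k1 [k2 [/in_K_inverse[k1O [v1 v1O v1K]] /in_K_inverse[k2O [v2 v2O v2K]] ->]]]].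
set D := zdiag _ _; pose D' : 'M[laurent k]_n := diag_mx (\row_i z ^+ ~~ (i < l)%N).
have DE : D = diag_mx (\row_i z ^+ (i < l)%N).
  by congr diag_mx; apply/rowP => i; rewrite !mxE tnth_mktuple; case: ifP.
have diagO (f : 'I_n -> nat) : diag_mx (\row_i z ^+ f i) \is a mxOver O.
  rewrite mxOver_diag ?rpred0 //; apply/mxOverP => i j.
  by rewrite mxE rpredX // lz_integral.
split; first by rewrite DE; do 2?[apply: mxOverM => //]; apply: diagO.
exists (v2 *m D' *m v1); first by do 2?[apply: mxOverM => //]; apply: diagO.
have D'D : D' *m D = z%:M.
  rewrite DE mul_diag_mx; apply/matrixP => i j; rewrite !mxE.
  by case: (i < l)%N; rewrite ?mul1r ?mulrnAr ?mulr1.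
rewrite -!mulmxA (mulmxA v1) v1K mul1mx (mulmxA D') D'D.
by rewrite mul_scalar_mx -scalemxAr v2K scalemx1.
Qed.

End Cosets.

(** * Decreasing sequences and the final bounds *)

(** The entries above [x] form an initial segment, indexed from 0. *)
Lemma sorted_ge_nth (s : seq int) (x : int) i : sorted >=%R s -> (i < size s)%N ->
  (x < nth 0 s i) = (i < count (fun y => (x < y)%R) s)%N.
Proof.
elim: s i => // y s IHs i /= ys; have s_sorted := path_sorted ys.
have ge_y : all (fun w => w <= y) s.
  by apply: order_path_min ys => u v w /= uv vw; apply: le_trans vw uv.
have [xy|yx] := ltP x y; first by case: i => [|i] //= ?; rewrite IHs.
have c0 : count (fun w => x < w) s = 0%N.
  apply/eqP; rewrite -leqn0 leqNgt -has_count -all_predC.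
  by apply: sub_all ge_y => w wy /=; rewrite -leNgt (le_trans wy yx).
case: i => [|i] /= si; first by rewrite c0 ltNge yx.
by rewrite IHs // c0.
Qed.

(** Take m = a_i, a natural number by nonnegativity. If b_i > m + 1, then more than i entries of b
    exceed m + 1, so more than i entries of a exceed m, and a_i > m. *)
Lemma sorted_ge_step n (a b : n.-tuple int) :
  sorted >=%R a -> sorted >=%R b -> (forall i, 0 <= tnth a i) ->
  (forall m : nat, 
    (count (fun y => (m.+1%:Z < y)%R) b <= count (fun y => (m%:Z < y)%R) a)%N) ->
  forall i, tnth b i <= tnth a i + 1.
Proof.
move=> sa sb a0 ab i; rewrite leNgt; apply/negP => lt_ab.
have [m am] : exists m : nat, tnth a i = m%:Z.
  by exists `|tnth a i|%N; rewrite gez0_abs.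
have: (m%:Z < tnth a i); last by rewrite am ltxx.
rewrite (tnth_nth 0) sorted_ge_nth ?size_tuple //; apply: leq_trans (ab m).
rewrite -sorted_ge_nth ?size_tuple // -tnth_nth.
by rewrite -addn1 PoszD -am.
Qed.

Theorem theorem2p2 (k : finFieldType) (hk : 2%N \notin [pchar k])
  (n l : nat) (hl : (l <= n)%N)
  (A B : 'M[laurent k]_n) (hA : in_G A) (hB : in_G B)
  (hrho : dominant_coweight A [tuple (if (i < l)%N then 1 else 0) | i < n])
  (a b : n.-tuple int)
  (ha : symmetric_coweight B a)
  (hb : symmetric_coweight (A *m B) b) :
  forall i : 'I_n, tnth a i - 1 <= tnth b i <= tnth a i + 1.
Proof.
have [AO [A' A'O A'A]] := minuscule_integral hrho.
have [e1 [t1 [u1 [h1 [t1_inj et1 [u1K h1H BE] sa cnta]]]]] :=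
  symmetric_coweight_model ha.
have [e2 [t2 [u2 [h2 [t2_inj et2 [u2K h2H ABE] sb cntb]]]]] :=
  symmetric_coweight_model hb.
have [u1O [v1 v1O v1K]] := in_K_inverse u1K.
have [u2O [v2 v2O v2K]] := in_K_inverse u2K.
(* The factors from K are absorbed into the integral matrices on the left. *)
have E1 : v2 *m A *m u1 *m (sym_model k e1 t1 *m h1) = sym_model k e2 t2 *m h2.
  rewrite -!mulmxA (mulmxA u1) -BE ABE.
  by rewrite !mulmxA v2K mul1mx.
have E2 : v1 *m A' *m u2 *m (sym_model k e2 t2 *m h2) =
    lz k *: (sym_model k e1 t1 *m h1).
  rewrite -!mulmxA (mulmxA u2) -ABE (mulmxA A') A'A mul_scalar_mx BE.
  by rewrite -scalemxAr !mulmxA v1K mul1mx.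
have steps m := model_exponent_le m t1_inj et1 t2_inj et2 h1H h2H
  (mxOverM (mxOverM v2O AO) u1O) (mxOverM (mxOverM v1O A'O) u2O) E1 E2.
have ge0 (c : n.-tuple int) (e : 'I_n -> nat) :
    (forall p : pred int, count p c = #|[set j | p (e j)%:Z]|) ->
  forall i, 0 <= tnth c i.
  move=> cnt i; have /allP : all (fun x : int => 0 <= x) c.
    rewrite all_count cnt size_tuple -[X in _ == X]card_ord; apply/eqP.
    by rewrite -cardsT; apply: eq_card => j; rewrite !inE.
  by apply; apply: mem_tnth.
(* The lower bound is the upper one with a and b exchanged. *)
move=> i; rewrite lerBlDr; apply/andP; split; apply: sorted_ge_step => //.
- exact: ge0 cntb.
- by move=> m; rewrite cnta cntb; case: (steps m).
- exact: ge0 cnta.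
- by move=> m; rewrite cnta cntb; case: (steps m).
Qed.
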